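(* Let $p \ge 5$ be a prime and let $b,c,d$ be integers with $\gcd(b^2-3c,p)=1$ such that the cubic polynomial $x^3+bx^2+cx+d$ is irreducible modulo $p$. Let $c_0,c_1,c_2$ be any integers such that $x^p \equiv c_2x^2+c_1x+c_0 \bmod \langle x^3+bx^2+cx+d\rangle$ in $\mathbb{F}_p[x]$. Then $c_2$ is invertible modulo $p$, and setting $t \equiv (b^2-3c)(c_2)^{-1} \pmod p$, we have \[ t^2 \equiv (18bcd-4b^3d+b^2c^2)-(4c^3+27d^2) \pmod p. \]
   Context: Here $x^p \bmod \langle f \rangle$ denotes the remainder of $x^p$ upon division by $f$ in $\mathbb{F}_p[x]$, i.e. reduction in the quotient ring $\mathbb{F}_p[x]/\langle f\rangle$; coefficients are taken modulo $p$. *)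

(* Defs.v *)
From HB Require Import structures.
From mathcomp Require Import all_boot all_order all_algebra.

Set Implicit Arguments.
Unset Strict Implicit.
Unset Printing Implicit Defensive.

Import GRing.Theory.
Local Open Scope ring_scope.

Definition Fp_poly (p : nat) (P : {poly int}) : {poly 'F_p} :=
  map_poly (intr : int -> 'F_p) P.

Definition cubic (b c d : int) : {poly int} :=
  'X^3 + b%:P * 'X^2 + c%:P * 'X + d%:P.

(* Main.v *)
Require Import Defs.
From mathcomp Require Import all_boot all_order all_algebra.
From mathcomp Require Import all_field ring.

Import GRing.Theory.
Local Open Scope ring_scope.

(** Adjoin to [F_p] a root [x] of the cubic. Its roots are then [x], [y = x^p]
    and [z = y^p], and the Frobenius map, which on the roots is the quadratic
    polynomial [g = c2 X^2 + c1 X + c0], permutes them cyclically. Lagrange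
    interpolation of [x |-> y |-> z |-> x] expresses the leading coefficient
    of [g]: [c2 V] is, up to sign, [x^2 + y^2 + z^2 - x y - y z - z x], which is
    [b^2 - 3 c], where [V = (x - y)(y - z)(z - x)] has the discriminant as its
    square. *)

Lemma eqz_mod_Fp (p : nat) (m n : int) : prime p ->
  (m = n %[mod p%:Z])%Z <-> m%:~R = n%:~R :> 'F_p.
Proof.
move=> p_pr; have chFp := pchar_Fp p_pr.
have E : (m == n %[mod p%:Z])%Z = (m%:~R == n%:~R :> 'F_p).
  by rewrite eqz_mod_dvd (dvdz_pcharf chFp) intrB subr_eq0.
by split=> /eqP H; apply/eqP; [rewrite -E | rewrite E].
Qed.

Lemma size_monic_cubic (F : fieldType) (b c d : F) :
  size ('X^3 + b%:P * 'X^2 + c%:P * 'X + d%:P) = 4.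
Proof.
rewrite -!addrA size_polyDl ?size_polyXn // addrA.
rewrite mul_polyC mul_polyC (leq_ltn_trans (size_polyD _ _)) // gtn_max.
rewrite (leq_ltn_trans (size_polyC_leq1 _)) // andbT.
rewrite (leq_ltn_trans (size_polyD _ _)) // gtn_max.
rewrite (leq_ltn_trans (size_scale_leq _ _)) ?size_polyXn //=.
by rewrite (leq_ltn_trans (size_scale_leq _ _)) ?size_polyX.
Qed.

Lemma irreducible_no_root (F : fieldType) (f : {poly F}) (a : F) :
  irreducible_poly f -> (2 < size f)%N -> ~~ root f a.
Proof.
move=> [_ irrf] szf; apply/negP; rewrite root_factor_theorem => Xaf.
have sz2 := size_XsubC a.
have : 'X - a%:P %= f by apply: irrf; rewrite ?sz2.
by move/eqp_size; rewrite sz2 => szfE; rewrite -szfE in szf.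
Qed.

(** With q = [#|F|], the polynomial X^q - X is the product of all X - a with a in [F], so [iota]
    maps it to a product of linear factors with roots in the image of [F]. *)
Lemma fixed_Frobenius_in_base (F : finFieldType) (L : fieldType)
    (iota : {rmorphism F -> L}) (x : L) :
  x ^+ #|F| = x -> exists a, x = iota a.
Proof.
move=> xF; have : root (map_poly iota ('X^#|F| - 'X)) x.
  by rewrite rmorphB /= map_polyXn map_polyX rootE !hornerE xF subrr.
rewrite finField_genPoly rmorph_prod rootE horner_prod.
move=> /prodf_eq0[a _]; rewrite /= map_polyXsubC !hornerE subr_eq0 => /eqP->.
by exists a.
Qed.

(** Since [phi] fixes the coefficients, it sends roots to roots, and by [noroot] it fixes none of
    them. Divided differences along the orbit then yield Vieta's formulas. *)
Lemma cubic_roots_orbit (L : fieldType) (phi : {rmorphism L -> L})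
    (b c d x : L) :
  phi b = b -> phi c = c -> phi d = d ->
  (forall u, phi u = u -> u ^+ 3 + b * u ^+ 2 + c * u + d != 0) ->
  x ^+ 3 + b * x ^+ 2 + c * x + d = 0 ->
  let y := phi x in let z := phi y in
  [/\ phi z = x, b = - (x + y + z), c = x * y + y * z + z * x
    & d = - (x * y * z)].
Proof.
move=> phib phic phid noroot fx y z.
have phif u : phi (u ^+ 3 + b * u ^+ 2 + c * u + d)
    = phi u ^+ 3 + b * phi u ^+ 2 + c * phi u + d.
  by rewrite -{2}phib -{2}phic -{2}phid; ring.
have fy : y ^+ 3 + b * y ^+ 2 + c * y + d = 0 by rewrite -phif fx rmorph0.
have fz : z ^+ 3 + b * z ^+ 2 + c * z + d = 0 by rewrite -phif fy rmorph0.
have neq_xy : x - y != 0.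
  by apply/eqP=> /subr0_eq xy; move: (noroot x);
     rewrite fx eqxx => /(_ (esym xy)).
have neq_yz : y - z != 0 by rewrite -rmorphB fmorph_eq0.
(* The left side is the divided difference (f(x) - f(y)) / (x - y) of the cubic f. *)
have dxy : x ^+ 2 + x * y + y ^+ 2 + b * (x + y) + c = 0.
  by apply: (mulfI neq_xy); rewrite mulr0 -[RHS](subrr 0) -{1}fx -fy; ring.
have dyz : y ^+ 2 + y * z + z ^+ 2 + b * (y + z) + c = 0.
  by apply: (mulfI neq_yz); rewrite mulr0 -[RHS](subrr 0) -{1}fy -fz; ring.
have cE : c = - (x ^+ 2 + x * y + y ^+ 2 + b * (x + y)).
  by apply/eqP; rewrite -addr_eq0 addrC dxy.
have dE : d = - (x ^+ 3 + b * x ^+ 2 + c * x).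
  by apply/eqP; rewrite -addr_eq0 addrC fx.
have /eqP : (x - z) * (x + y + z + b) = 0.
  by rewrite -[RHS](subrr 0) -{1}dxy -dyz; ring.
rewrite mulf_eq0 => /orP[/eqP/subr0_eq xz|/eqP sum0].
  (* [phi] would swap [x] and [y], hence fix the third root. *)
  have /noroot/eqP[] : phi (- b - x - y) = - b - x - y.
    by rewrite !rmorphB rmorphN /= phib -/y -/z -xz addrAC.
  by rewrite dE cE; ring.
have bE : b = - (x + y + z) by apply/eqP; rewrite -addr_eq0 addrC sum0.
split=> //; last 2 first.
- by rewrite cE bE; ring.
- by rewrite dE cE bE; ring.
(* Applying [phi] to this expression gives - b - y - z, which is [x]. *)
have zE : z = - b - x - y by rewrite bE; ring.
by rewrite {1}zE !rmorphB rmorphN /= phib -/y -/z bE; ring.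
Qed.

Lemma quadratic_3cycle_lead (R : comNzRingType) (c0 c1 c2 x y z : R) :
  c2 * x ^+ 2 + c1 * x + c0 = y -> c2 * y ^+ 2 + c1 * y + c0 = z ->
  c2 * z ^+ 2 + c1 * z + c0 = x ->
  c2 * ((x - y) * (y - z) * (z - x))
    = - (x ^+ 2 + y ^+ 2 + z ^+ 2 - x * y - y * z - z * x).
Proof.
move=> gx gy gz.
(* In this alternating sum the terms in [c1] and [c0] cancel, and those in [c2] give the Vandermonde
   product. *)
transitivity (- ((c2 * x ^+ 2 + c1 * x + c0) * (y - z)
  + (c2 * y ^+ 2 + c1 * y + c0) * (z - x)
  + (c2 * z ^+ 2 + c1 * z + c0) * (x - y))); first by ring.
by rewrite gx gy gz; ring.
Qed.

(** Squaring removes the dependence of V on the order of the roots. The relation is kept free of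
    division so that [c2 != 0] can be deduced from it. *)
Lemma sqr_lead_coef_disc (p : nat) (b c d c0 c1 c2 : 'F_p) :
  prime p ->
  let f := 'X^3 + b%:P * 'X^2 + c%:P * 'X + d%:P in
  irreducible_poly f ->
  'X^p %% f = (c2%:P * 'X^2 + c1%:P * 'X + c0%:P) %% f ->
  (b ^+ 2 - 3 * c) ^+ 2
    = c2 ^+ 2 * ((18 * b * c * d - 4 * b ^+ 3 * d + b ^+ 2 * c ^+ 2)
                 - (4 * c ^+ 3 + 27 * d ^+ 2)).
Proof.
move=> p_pr f irrf /eqP; rewrite -subr_eq0 -modpN -modpD => fdvd.
have [L _ [x fx _]] := irredp_FAdjoin irrf.
pose i := in_alg L.
have chL : p \in [pchar L] by rewrite (fmorph_pchar i) pchar_Fp.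
pose phi : {rmorphism L -> L} := pFrobenius_aut chL.
have phiE u : phi u = u ^+ p by [].
have phi_i a : phi (i a) = i a.
  by rewrite phiE -rmorphXn /=; have := expf_card a; rewrite card_Fp // => ->.
have fE u : (map_poly i f).[u] = u ^+ 3 + i b * u ^+ 2 + i c * u + i d.
  by rewrite !rmorphD /= ![map_poly _ (_%:P * _)]rmorphM /=
     !map_polyC /= !map_polyXn map_polyX !hornerE.
(* An element fixed by Frobenius lies in F_p, where an irreducible cubic has no root. *)
have noroot u : phi u = u -> u ^+ 3 + i b * u ^+ 2 + i c * u + i d != 0.
  rewrite phiE => up.
  have [a ->] : exists a, u = i a.
    by apply: fixed_Frobenius_in_base; rewrite card_Fp.
  rewrite -fE horner_map fmorph_eq0.
  by rewrite -rootE; apply: irreducible_no_root; rewrite ?size_monic_cubic.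
(* As [f] divides X^p - g, every root of [f] is also a root of X^p - g. *)
have gE u : (map_poly i f).[u] = 0 ->
    i c2 * u ^+ 2 + i c1 * u + i c0 = phi u.
  move=> fu; apply/esym/eqP; rewrite -subr_eq0 phiE.
  have : map_poly i f
      %| map_poly i ('X^p - (c2%:P * 'X^2 + c1%:P * 'X + c0%:P)).
    by rewrite dvdp_map.
  case/dvdpP=> q /(congr1 (horner^~ u)); rewrite hornerM fu mulr0.
  rewrite rmorphB /= !rmorphD /= ![map_poly _ (_%:P * _)]rmorphM /=
     !map_polyC /= !map_polyXn map_polyX.
  by rewrite !hornerE => ->.
have rootx : x ^+ 3 + i b * x ^+ 2 + i c * x + i d = 0.
  by rewrite -fE; apply/eqP.
have [phiz bE cE dE] :=
  cubic_roots_orbit _ phi _ _ _ _ (phi_i b) (phi_i c) (phi_i d) noroot rootx.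
set y := phi x in phiz bE cE dE; set z := phi y in phiz bE cE dE.
have fy : (map_poly i f).[y] = 0 by rewrite fE bE cE dE; ring.
have fz : (map_poly i f).[z] = 0 by rewrite fE bE cE dE; ring.
have gx : i c2 * x ^+ 2 + i c1 * x + i c0 = y by apply: gE; apply/eqP.
have gz : i c2 * z ^+ 2 + i c1 * z + i c0 = x by rewrite gE.
have c2V := quadratic_3cycle_lead _ _ _ _ _ _ _ gx (gE _ fy) gz.
(* The identity is checked in [L], where Vieta's formulas make both sides polynomials in the
   roots. *)
apply: (fmorph_inj i).
transitivity ((i b ^+ 2 - 3 * i c) ^+ 2); first by rewrite /i; ring.
transitivity ((i c2 * ((x - y) * (y - z) * (z - x))) ^+ 2).
  by rewrite c2V bE cE; ring.
transitivity (i c2 ^+ 2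
  * ((18 * i b * i c * i d - 4 * i b ^+ 3 * i d + i b ^+ 2 * i c ^+ 2)
     - (4 * i c ^+ 3 + 27 * i d ^+ 2))); last by rewrite /i; ring.
by rewrite bE cE dE; ring.
Qed.

Theorem theorem3 (p : nat) (b c d c0 c1 c2 : int) :
  prime p -> (5 <= p)%N ->
  gcdz (b ^+ 2 - 3 * c) p%:Z = 1 ->
  irreducible_poly (Fp_poly p (cubic b c d)) ->
  'X^p %% Fp_poly p (cubic b c d)
    = Fp_poly p (c2%:P * 'X^2 + c1%:P * 'X + c0%:P)
        %% Fp_poly p (cubic b c d) ->
  (exists u : int, (c2 * u = 1 %[mod p%:Z])%Z) /\
  (forall u t : int,
     (c2 * u = 1 %[mod p%:Z])%Z ->
     (t = (b ^+ 2 - 3 * c) * u %[mod p%:Z])%Z ->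
     (t ^+ 2 = (18 * b * c * d - 4 * b ^+ 3 * d + b ^+ 2 * c ^+ 2)
               - (4 * c ^+ 3 + 27 * d ^+ 2) %[mod p%:Z])%Z).
Proof.
move=> p_pr _ /eqP cop irrf Xp.
have gE : Fp_poly p (c2%:P * 'X^2 + c1%:P * 'X + c0%:P)
    = (c2%:~R)%:P * 'X^2 + (c1%:~R)%:P * 'X + (c0%:~R)%:P.
  by rewrite /Fp_poly !rmorphD /= ![map_poly _ (_%:P * _)]rmorphM /=
     !map_polyC map_polyXn map_polyX.
have fE : Fp_poly p (cubic b c d)
    = 'X^3 + (b%:~R)%:P * 'X^2 + (c%:~R)%:P * 'X + (d%:~R)%:P.
  by rewrite /Fp_poly !rmorphD /= ![map_poly _ (_%:P * _)]rmorphM /=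
     !map_polyC !map_polyXn map_polyX.
rewrite gE fE in Xp; rewrite fE in irrf.
have := sqr_lead_coef_disc _ _ _ _ _ _ _ p_pr irrf Xp.
set D := (X in _ = _ * X) => key.
have nz : (b ^+ 2 - 3 * c)%:~R != 0 :> 'F_p.
  rewrite -(dvdz_pcharf (pchar_Fp p_pr)); apply/negP => dv.
  move: cop; rewrite gcdzC; move/gcdz_idPl: dv => ->.
  by rewrite absz_nat eqz_nat gtn_eqF ?prime_gt1.
have e : (b ^+ 2 - 3 * c)%:~R = b%:~R ^+ 2 - 3 * c%:~R :> 'F_p by ring.
(* If [c2] vanished modulo p, [key] would force b^2 - 3c to vanish as well. *)
have c2nz : c2%:~R != 0 :> 'F_p.
  apply: contraNneq nz => c20; rewrite e -sqrf_eq0 key c20.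
  by rewrite expr0n mul0r.
split.
  (* The witness is the natural number representing the inverse of [c2] in F_p. *)
  exists ((c2%:~R : 'F_p)^-1 : nat)%:Z; apply/eqz_mod_Fp => //.
  by rewrite intrM -pmulrn natr_Zp divff.
move=> u t /(eqz_mod_Fp _ _ _ p_pr) c2u /(eqz_mod_Fp _ _ _ p_pr) tE.
apply/(eqz_mod_Fp _ _ _ p_pr).
have uE : c2%:~R * u%:~R = 1 :> 'F_p by rewrite -intrM.
transitivity ((t%:~R : 'F_p) ^+ 2); first by ring.
rewrite tE intrM exprMn e key.
(* By [key], t^2 has become c2^2 D u^2, and [c2] cancels against its inverse [u]. *)
transitivity ((c2%:~R * u%:~R) ^+ 2 * D); first by ring.
by rewrite uE expr1n mul1r /D; ring.
Qed.
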